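(* The generating function $A=\sum_{n\ge0}A_n^{FC}(q)x^n$ of fully commutative elements of type $A$ satisfies $$A=\frac{\sum_{k\ge0}x^k\sum_{i=0}^k{k\brack i}{k+1\brack i+1}q^{-i(k-i)}}{1+\sum_{k\ge1}x^k\sum_{i=0}^{k-1}{k-1\brack i}{k\brack i}q^{-i(k-i)}},$$ where ${k\brack i}=\frac{(q;q)_k}{(q;q)_i(q;q)_{k-i}}$ is the $q$-binomial coefficient.
   Context: $A_n$ is the Coxeter group of type $A_n$ (symmetric group on $n+1$ letters, generated by the $n$ adjacent transpositions), $A_0$ trivial. An element $w$ is fully commutative (fc) if any reduced expression can be obtained from any other using only commutation relations $st=ts$ ($m_{st}=2$); $A_n^{FC}(q)=\sum_{w\ \mathrm{fc}}q^{\ell(w)}$ with $\ell$ the Coxeter length. $(a;q)_n=(1-a)(1-aq)\cdots(1-aq^{n-1})$. *)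

(* Defs.v *)
From HB Require Import structures.
From mathcomp Require Import all_boot all_order all_fingroup all_algebra.

Set Implicit Arguments.
Unset Strict Implicit.
Unset Printing Implicit Defensive.

Import GRing.Theory.

(* The Coxeter group A_n is 'S_n.+1, acting on {0, .., n}, with simple
   reflections s_i = (i i+1) indexed by i : 'I_n.  An expression is a tuple of
   indices. *)
Section CoxeterA.
Variable n : nat.

Definition simple (i : 'I_n) : 'S_n.+1 :=
  tperm (widen_ord (leqnSn n) i) (lift ord0 i).

Definition cox_m (i j : 'I_n) : nat := #[simple i * simple j]%g.

Definition is_expr (w : 'S_n.+1) k (u : k.-tuple 'I_n) : bool :=
  (\prod_(i <- u) simple i)%g == w.

Lemma tperm_gen_simple (x y : 'I_n.+1) :
  tperm x y \in <<[set simple i | i in 'I_n]>>%g.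
Proof.
wlog le_xy : x y / x <= y => [W|].
  by case/orP: (leq_total x y) => [|/W]; [apply: W | rewrite tpermC].
have [d] := ubnP (y - x); elim: d y le_xy => // d IHd y le_xy ltd.
have [->|neq_xy] := eqVneq x y; first by rewrite tperm1 group1.
have lt_xy : x < y by rewrite ltn_neqAle neq_xy.
have ltyn : y.-1 < n by rewrite -ltnS (ltn_predK lt_xy) ltn_ord.
pose i := Ordinal ltyn.
have Dy : lift ord0 i = y.
  by apply: val_inj; rewrite /= /bump /= add1n (ltn_predK lt_xy).
set z := widen_ord (leqnSn n) i.
have Dz : z = y.-1 :> nat by [].
have Gi : simple i \in <<[set simple i | i in 'I_n]>>%g.
  by apply/mem_gen/imset_f.
have [xz|xz] := eqVneq x z; first by rewrite xz -Dy.
have -> : tperm x y = (tperm x z ^ simple i)%g.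
  by rewrite tpermJ /simple Dy tpermL tpermD // 1?eq_sym.
rewrite groupJ // IHd // Dz.
  by rewrite -ltnS (ltn_predK lt_xy).
by rewrite -ltnS (leq_trans _ ltd) // ltnS ltn_sub2r // (ltn_predK lt_xy).
Qed.

Lemma expr_ex (w : 'S_n.+1) :
  exists k, [exists u : k.-tuple 'I_n, is_expr w u].
Proof.
have : w \in <<[set simple i | i in 'I_n]>>%g.
  have [ts -> _] := prod_tpermP w.
  by rewrite group_prod // => t _; apply: tperm_gen_simple.
case/gen_prodgP=> k [c Sc ->]; exists k.
have /fin_all_exists [f Df] i : exists j, c i = simple j.
  by have /imsetP[j _ ->] := Sc i; exists j.
apply/existsP; exists [tuple f i | i < k]; rewrite /is_expr big_tuple.
by apply/eqP/eq_bigr => i _; rewrite tnth_mktuple Df.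
Qed.

Definition cox_length (w : 'S_n.+1) : nat := ex_minn (expr_ex w).

(* v is obtained from u by exchanging the letters s, t at the adjacent
   positions p, p+1, where m_st = 2. *)
Definition comm_step k (u v : k.-tuple 'I_n) : bool :=
  [exists p : 'I_k, exists r : 'I_k,
    [&& r == p.+1 :> nat,
        cox_m (tnth u p) (tnth u r) == 2
      & v == [tuple tnth u (tperm p r x) | x < k]]].

Definition fully_commutative (w : 'S_n.+1) : bool :=
  [forall u : (cox_length w).-tuple 'I_n, forall v : (cox_length w).-tuple 'I_n,
    is_expr w u ==> is_expr w v ==> connect (@comm_step (cox_length w)) u v].

End CoxeterA.

Local Open Scope ring_scope.

Definition AFC (R : nzRingType) (q : R) (n : nat) : R :=
  \sum_(w : 'S_n.+1 | fully_commutative w) q ^+ cox_length w.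

Definition qpoch (R : nzRingType) (a q : R) (n : nat) : R :=
  \prod_(j < n) (1 - a * q ^+ j).

Definition qbinom (F : fieldType) (q : F) (k i : nat) : F :=
  qpoch q q k / (qpoch q q i * qpoch q q (k - i)).

(* A formal power series in x is the function giving its coefficients. *)
Section PowerSeries.
Variable F : fieldType.

Definition fps : Type := nat -> F.

Definition fps_mul (f g : fps) : fps :=
  fun n => \sum_(i < n.+1) f i * g (n - i)%N.

(* The first n coefficients of f / g, by long division. *)
Fixpoint fps_div_prefix (f g : fps) (n : nat) : seq F :=
  if n is m.+1 then
    let h := fps_div_prefix f g m in
    rcons h ((f m - \sum_(i < m) h`_i * g (m - i)%N) / g 0%N)
  else [::].

Definition fps_div (f g : fps) : fps := fun n => (fps_div_prefix f g n.+1)`_n.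

Lemma size_fps_div_prefix f g n : size (fps_div_prefix f g n) = n.
Proof. by elim: n => //= n IHn; rewrite size_rcons IHn. Qed.

Lemma nth_fps_div_prefix f g n i :
  (i < n)%N -> (fps_div_prefix f g n)`_i = fps_div f g i.
Proof.
elim: n => // n IHn; rewrite ltnS leq_eqVlt => /predU1P[-> //|lt_in].
by rewrite /= nth_rcons size_fps_div_prefix lt_in IHn.
Qed.

Lemma fps_divE f g n :
  fps_div f g n = (f n - \sum_(i < n) fps_div f g i * g (n - i)%N) / g 0%N.
Proof.
rewrite {1}/fps_div /= nth_rcons size_fps_div_prefix ltnn eqxx.
by congr ((_ - _) / _); apply: eq_bigr => i _; rewrite nth_fps_div_prefix.
Qed.

Lemma fps_divP f g h : g 0%N != 0 ->
  fps_mul h g =1 f <-> h =1 fps_div f g.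
Proof.
move=> g0; split=> [Dhg n | Dh n]; last first.
  rewrite /fps_mul big_ord_recr subnn /= Dh fps_divE mulfVK //.
  by under eq_bigr do rewrite Dh; rewrite addrC subrK.
have [m] := ubnP n; elim: m n => // m IHm n lt_nm.
rewrite fps_divE -Dhg /fps_mul big_ord_recr subnn /=.
rewrite (eq_bigr (fun i : 'I_n => fps_div f g i * g (n - i)%N)).
  by rewrite addrAC subrr add0r mulfK.
by move=> i _; rewrite IHm // (leq_trans (ltn_ord i)).
Qed.

End PowerSeries.

(* The coefficient field Q(q) and its indeterminate q. *)
Definition Qq : fieldType := {fraction {poly int}}.
Definition q : Qq := tofrac ('X : {poly int}).

(* Main.v *)
Require Import Defs.
From mathcomp Require Import all_boot all_order all_fingroup all_algebra.
From mathcomp Require Import cyclic zify ring.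

(** The Coxeter length on ['S_n.+1] is the number of inversions, and an element
    is fully commutative iff it avoids the pattern 321: two descents of a
    321-avoiding permutation are never adjacent, so reduced words starting
    with different letters are related by a commutation, whereas a 321 pattern yields
    a reduced word with a braid factor [s t s], and [t s t] has another letter
    content.  Inserting the largest value makes the 321-avoiding permutations a
    generating tree whose state is the length [r] of the final increasing run:
    [r] goes to [r + 1] with weight [1], or to [1 <= t <= r] with weight [q^t].

    The tree is equivalent to a transfer matrix of Motzkin paths with two kinds
    [L], [R] of level steps, [R] being forbidden at height [0], weighted by [q]
    to the sum of the heights.  Without positivity such paths are pairs of
    lattice paths with common ends, weighted by the signed area between them,
    and are counted by products of q-binomial coefficients.  Cutting a signed
    path at the first point of height [0] that is followed by a down step or an
    [R] step writes it as a Motzkin path followed by a signed path starting with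
    such a step; this is the identity (numerator) = A * (denominator). *)

Set Implicit Arguments.
Unset Strict Implicit.
Unset Printing Implicit Defensive.

Import GRing.Theory.

(** * Reduced words and pattern avoidance *)

Definition inversions n (w : 'S_n) : nat :=
  \sum_(p : 'I_n * 'I_n | p.1 < p.2) (w p.2 < w p.1).

Lemma inversionsE n (w : 'S_n) :
  inversions w = \sum_(i < n) \sum_(j < n) ((i < j) && (w j < w i)).
Proof.
rewrite pair_big /= /inversions big_mkcond; apply: eq_bigr => -[i j] _ /=.
by case: ltnP.
Qed.

Definition has321 n (w : 'S_n) : bool :=
  [exists a : 'I_n, exists b : 'I_n, exists c : 'I_n,
    [&& a < b, b < c, w b < w a & w c < w b]].

Lemma has321P n (w : 'S_n) :
  reflect (exists a b c : 'I_n, [/\ a < b, b < c, w b < w a & w c < w b])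
          (has321 w).
Proof.
apply: (iffP existsP) => [[a /existsP[b /existsP[c /and4P[? ? ? ?]]]]|].
  by exists a, b, c.
case=> a [b [c [? ? ? ?]]]; exists a; apply/existsP; exists b; apply/existsP.
by exists c; apply/and4P.
Qed.

Section Words.
Variable n : nat.
Implicit Types (k : 'I_n) (w : 'S_n.+1).

Local Notation lo k := (widen_ord (leqnSn n) k).
Local Notation hi k := (lift ord0 k).

Lemma hiE k : hi k = k.+1 :> nat. Proof. by rewrite lift0. Qed.

Lemma lo_neq_hi k : lo k != hi k.
Proof. by rewrite -val_eqE /= /bump /=; lia. Qed.

Lemma simple_lo k : simple k (lo k) = hi k. Proof. exact: tpermL. Qed.
Lemma simple_hi k : simple k (hi k) = lo k. Proof. exact: tpermR. Qed.

Lemma simple_out k (x : 'I_n.+1) : x != k :> nat -> x != k.+1 :> nat ->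
  simple k x = x.
Proof.
move=> xk xk1; rewrite /simple tpermD //; apply/eqP => e.
  by case/eqP: xk; rewrite -e.
by case/eqP: xk1; rewrite -e hiE.
Qed.

Lemma simple_sqr k : (simple k * simple k = 1)%g. Proof. exact: tperm2. Qed.

Lemma simple_mulK k w : (simple k * (simple k * w) = w)%g.
Proof. by rewrite mulgA simple_sqr mul1g. Qed.

Lemma simple_val k (x : 'I_n.+1) :
  simple k x = (if x == k :> nat then k.+1
                else if x == k.+1 :> nat then k : nat else x) :> nat.
Proof.
case: eqP => [e|/eqP ne].
  have -> : x = lo k by apply: ord_inj.
  by rewrite simple_lo hiE.
case: eqP => [e|/eqP ne1]; last by rewrite simple_out.
have -> : x = hi k by apply: ord_inj; rewrite e hiE.
by rewrite simple_hi.
Qed.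

Lemma simple_lt k (i j : 'I_n.+1) :
  i < j -> ~~ ((i == k :> nat) && (j == k.+1 :> nat)) ->
  simple k i < simple k j.
Proof. by rewrite !simple_val; do ?case: eqP => ?; lia. Qed.

(** Products compose from left to right, so [simple k * w] is [w] with the values at positions [k]
    and [k.+1] exchanged; descents are the possible first letters of reduced words. *)
Definition descent w k : bool := w (hi k) < w (lo k).

Lemma descent_simple w k : descent (simple k * w)%g k = ~~ descent w k.
Proof.
rewrite /descent !permM simple_lo simple_hi.
have ne : w (lo k) <> w (hi k) :> nat.
  by move/ord_inj/perm_inj/eqP; rewrite (negPf (lo_neq_hi k)).
lia.
Qed.

(** Apart from the pair of positions [k], [k.+1], applying [simple k] to both coordinates permutes
    the increasing pairs and matches the inversions of the two permutations. *)
Lemma inversions_descent w k :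
  descent w k -> inversions w = (inversions (simple k * w)%g).+1.
Proof.
move=> dk; have dk' := descent_simple w k; rewrite dk /= in dk'.
rewrite /inversions (bigD1 (lo k, hi k)) //=.
rewrite [in RHS](bigD1 (lo k, hi k)) //=.
move: dk dk'; rewrite /descent => -> ->; rewrite add0n add1n; congr _.+1.
pose f (p : 'I_n.+1 * 'I_n.+1) := (simple k p.1, simple k p.2).
have fK : involutive f.
  by case=> x y; rewrite /f /= -!permM simple_sqr !perm1.
rewrite (reindex_inj (inv_inj fK)) /=; apply: eq_big => [[x y]|[x y] _] /=.
  rewrite /f -!pair_eqE /= /pair_eq /= -!val_eqE /= /bump /= !simple_val.
  by do ?case: eqP => ? /=; lia.
by rewrite !permM.
Qed.

Lemma inversions_simple w k : inversions w <= (inversions (simple k * w)%g).+1.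
Proof.
case: (boolP (descent w k)) => dk; first by rewrite (inversions_descent dk).
have d' : descent (simple k * w)%g k by rewrite descent_simple.
by rewrite (inversions_descent d') simple_mulK; lia.
Qed.

Lemma inversions_expr (s : seq 'I_n) :
  inversions (\prod_(i <- s) simple i)%g <= size s.
Proof.
elim: s => [|k s IHs] /=.
  rewrite big_nil /inversions big1 // => p; rewrite !perm1 => lt12.
  by rewrite ltnNge ltnW.
rewrite big_cons (leq_trans (inversions_simple _ k)) // simple_mulK ltnS.
exact: IHs.
Qed.

(** Both [w] and its inverse are increasing, and an increasing permutation is pointwise at least the
    identity. *)
Lemma no_descent w : (forall k, ~~ descent w k) -> w = 1%g.
Proof.
move=> nd.
have step (i j : 'I_n.+1) : j = i.+1 :> nat -> w i < w j.
  move=> ji; have ltin : i < n by rewrite -ltnS -ji ltn_ord.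
  have := nd (Ordinal ltin); rewrite /descent -leqNgt leq_eqVlt.
  have -> : lo (Ordinal ltin) = i by apply: ord_inj.
  have -> : hi (Ordinal ltin) = j by apply: ord_inj; rewrite hiE.
  by case/predU1P => // /ord_inj/perm_inj e; move: ji; rewrite e; lia.
have mono (i j : 'I_n.+1) : i < j -> w i < w j.
  have [d] := ubnP (j - i); elim: d j => // d IHd j le_d lt_ij.
  have [e|ne] := eqVneq (j : nat) i.+1; first exact: step.
  have lt1 : j.-1 < n.+1 by have := ltn_ord j; lia.
  apply: (@ltn_trans (w (Ordinal lt1))); last by apply: step => /=; lia.
  by apply: IHd => /=; lia.
have mono' (i j : 'I_n.+1) : i < j -> (w^-1)%g i < (w^-1)%g j.
  move=> lt_ij; rewrite ltnNge leq_eqVlt; apply/negP => /predU1P[|/mono].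
    by move/ord_inj/perm_inj => e; move: lt_ij; rewrite e ltnn.
  by rewrite !permKV; lia.
have ge_id (v : 'S_n.+1) : (forall i j : 'I_n.+1, i < j -> v i < v j) ->
    forall i : 'I_n.+1, i <= v i.
  move=> vmono [i lti] /=; elim: i lti => // i IHi lti.
  have lti' : i < n.+1 by lia.
  by apply: leq_ltn_trans (IHi lti') (vmono _ _ _) => /=.
apply/permP => i; rewrite perm1; apply/ord_inj/eqP.
rewrite eqn_leq (ge_id _ mono) andbT.
by have := ge_id _ mono' (w i); rewrite permK.
Qed.

Lemma reduced_ex w : exists u : (inversions w).-tuple 'I_n, is_expr w u.
Proof.
move: {2}(inversions w) (erefl (inversions w)) => m; elim: m w => [|m IHm] w Dm.
  exists (tcast (esym Dm) [tuple]); rewrite /is_expr val_tcast big_nil eq_sym.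
  apply/eqP/no_descent => k; apply/negP => /inversions_descent; lia.
have /existsP[k dk] : [exists k, descent w k].
  apply/contraT; rewrite negb_exists => /forallP /no_descent w1.
  by move: Dm; rewrite w1; have := inversions_expr [::]; rewrite big_nil /=; lia.
have D := inversions_descent dk.
have [|u] := IHm (simple k * w)%g; first by lia.
rewrite /is_expr => /eqP Du.
exists (tcast (esym D) [tuple of k :: u]).
by rewrite /is_expr val_tcast big_cons Du simple_mulK.
Qed.

Lemma cox_lengthE w : cox_length w = inversions w.
Proof.
rewrite /cox_length; case: ex_minnP => m /existsP[u /eqP Du] min_m.
have := inversions_expr u; rewrite Du size_tuple => le_wm.
by apply/eqP; rewrite eqn_leq le_wm andbT; apply/min_m/existsP/reduced_ex.
Qed.

Lemma expr_cons w m k (u : m.-tuple 'I_n) :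
  is_expr w [tuple of k :: u] = is_expr (simple k * w)%g u.
Proof.
rewrite /is_expr /= big_cons; apply/eqP/eqP => [<-|->]; by rewrite simple_mulK.
Qed.

(** Moving the positions of a pattern by [simple k] can only spoil their order at [k], [k.+1], where
    [simple k * w] has no inversion. *)
Lemma has321_remove_descent w k :
  descent w k -> has321 (simple k * w)%g -> has321 w.
Proof.
rewrite -[descent w k]negbK -descent_simple => /negP nd /has321P[a [b [c [ab bc]]]].
move=> wba wcb; apply/has321P; exists (simple k a), (simple k b), (simple k c).
have nd' (i j : 'I_n.+1) : (simple k * w)%g j < (simple k * w)%g i ->
    ~~ ((i == k :> nat) && (j == k.+1 :> nat)).
  move=> lt_ji; apply/negP => /andP[/eqP ik /eqP jk]; apply: nd; rewrite /descent.
  have -> : lo k = i by apply: ord_inj.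
  by have -> : hi k = j by apply: ord_inj; rewrite hiE.
by rewrite -!permM; split=> //; apply: simple_lt => //; apply: nd'.
Qed.

Lemma simple_comm (s t : 'I_n) :
  s.+1 < t -> (simple s * simple t = simple t * simple s)%g.
Proof.
move=> lt_st; apply/commgP/conjg_fixP; rewrite [X in (X ^ _)%g]/simple tpermJ.
by rewrite !simple_out //= /bump /=; lia.
Qed.

Lemma cox_m_far (s t : 'I_n) : s.+1 < t -> cox_m s t = 2.
Proof.
move=> lt_st; rewrite /cox_m; apply/nt_prime_order => //.
  by rewrite expgS expg1 {1}simple_comm // -mulgA simple_mulK simple_sqr.
apply/eqP => /permP /(_ (lo s)); rewrite permM perm1 simple_lo => /(congr1 val) /=.
by rewrite simple_val hiE; do ?case: eqP => ?; lia.
Qed.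

Lemma cox_mC (s t : 'I_n) : cox_m s t = cox_m t s.
Proof.
rewrite /cox_m -[in LHS](orderJ _ (simple s)); congr #[_]%g.
by rewrite conjgE -!mulgA -/(simple s) (mulgA (simple s)^-1%g) mulVg mul1g.
Qed.

Lemma connect_cons m (s : 'I_n) (u v : m.-tuple 'I_n) :
  connect (@comm_step n m) u v ->
  connect (@comm_step n m.+1) [tuple of s :: u] [tuple of s :: v].
Proof.
case/connectP => p; elim: p u => [|x p IHp] u /=; first by move=> _ ->; apply: connect0.
case/andP => ux xp Dv; apply: connect_trans (IHp _ xp Dv); apply: connect1.
case/existsP: ux => i /existsP[j /and3P[/eqP ji cij /eqP Dx]].
apply/existsP; exists (lift ord0 i); apply/existsP; exists (lift ord0 j).
rewrite !lift0 ji eqxx !tnthS cij; apply/eqP/eq_from_tnth => y.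
rewrite tnth_mktuple; case: (unliftP ord0 y) => [z|] ->; last first.
  by rewrite tpermD ?tnth0 // eq_sym neq_lift.
rewrite tnthS Dx tnth_mktuple.
have -> : tperm (lift ord0 i) (lift ord0 j) (lift ord0 z) = lift ord0 (tperm i j z).
  by rewrite (inj_tperm _ _ _ (@lift_inj _ ord0)).
by rewrite tnthS.
Qed.

Lemma connect_swap m (s t : 'I_n) (u : m.-tuple 'I_n) : cox_m s t = 2 ->
  connect (@comm_step n m.+2) [tuple of s :: t :: u] [tuple of t :: s :: u].
Proof.
move=> st2; apply: connect1; apply/existsP; exists ord0; apply/existsP.
exists (lift ord0 ord0); rewrite lift0 eqxx tnth0 tnthS tnth0 st2 eqxx /=.
apply/eqP/eq_from_tnth => y; rewrite tnth_mktuple.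
case: (unliftP ord0 y) => [z|] ->; last by rewrite tpermL tnthS !tnth0.
case: (unliftP ord0 z) => [x|] ->; last by rewrite tpermR tnthS !tnth0.
by rewrite tpermD ?tnthS // ?(inj_eq lift_inj) eq_sym neq_lift.
Qed.

Lemma avoid_connect m w (u v : m.-tuple 'I_n) :
  inversions w = m -> ~~ has321 w ->
  is_expr w u -> is_expr w v -> connect (@comm_step n m) u v.
Proof.
elim: m w u v => [|m IHm] w u v Dm av.
  by rewrite (tuple0 u) (tuple0 v) => _ _; apply: connect0.
case/tupleP: u => s u; case/tupleP: v => t v; rewrite !expr_cons => Eu Ev.
have desc (r : 'I_n) (x : m.-tuple 'I_n) : is_expr (simple r * w)%g x ->
    descent w r /\ inversions (simple r * w)%g = m.
  rewrite /is_expr => /eqP Ex.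
  have le_m : inversions (simple r * w)%g <= m.
    by rewrite -Ex (leq_trans (inversions_expr _)) ?size_tuple.
  have [dr|nd] := boolP (descent w r); first by have := inversions_descent dr; lia.
  have /inversions_descent : descent (simple r * w)%g r by rewrite descent_simple.
  by rewrite simple_mulK; lia.
have [ds Ds] := desc _ _ Eu; have [dt Dt] := desc _ _ Ev.
have avs : ~~ has321 (simple s * w)%g by apply: contra (has321_remove_descent ds) av.
have avt : ~~ has321 (simple t * w)%g by apply: contra (has321_remove_descent dt) av.
have [e|ne_st] := eqVneq s t.
  by rewrite -e in Ev *; apply/connect_cons/(IHm _ _ _ Ds).
have far (x y : 'I_n) : descent w x -> descent w y -> x < y -> x.+1 < y.
  move=> dx dy lt_xy; rewrite ltn_neqAle lt_xy andbT; apply: contra av => /eqP xy.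
  apply/has321P; exists (lo x), (hi x), (hi y).
  have e : lo y = hi x by apply: ord_inj; rewrite hiE.
  by move: dy; rewrite /descent e !hiE; split=> //; rewrite ?ltnS.
have [st2 st_comm] : cox_m s t = 2 /\ (simple s * simple t = simple t * simple s)%g.
  have [/far|/far|/ord_inj/eqP] := ltngtP s t; last by rewrite (negPf ne_st).
    by move/(_ ds dt) => lt_st; split; [apply: cox_m_far | apply: simple_comm].
  by move/(_ dt ds) => lt_ts; rewrite cox_mC; split;
    [apply: cox_m_far | rewrite (simple_comm lt_ts)].
have ne_val : s != t :> nat by rewrite val_eqE.
have dst : descent (simple s * w)%g t.
  have far' : (s.+1 < t) || (t.+1 < s).
    by have [/(far _ _ ds dt)->|/(far _ _ dt ds)->|e] := ltngtP s t;
      rewrite ?orbT // e eqxx in ne_val *.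
  by rewrite /descent !permM !simple_out ?hiE //=; lia.
have D2 := inversions_descent dst.
(* [x] closes the diamond: induction links [s :: u] to [s :: t :: x] and [t :: s :: x] to [t :: v],
   and one swap links the two middle words. *)
have [x Ex] := reduced_ex (simple t * (simple s * w))%g.
case: m {IHm desc} (IHm) u v Dm Eu Ev Ds Dt => [|m] IH u v Dm Eu Ev Ds Dt.
  by lia.
have Dx : inversions (simple t * (simple s * w))%g = m by lia.
move: x Ex; rewrite Dx => x Ex.
apply: (@connect_trans _ _ [tuple of s :: t :: x]).
  by apply/connect_cons/(IH _ _ _ Ds avs Eu); rewrite expr_cons.
apply: connect_trans (connect_swap x st2) _.
apply/connect_cons/(IH _ _ _ Dt avt _ Ev).
by rewrite expr_cons mulgA st_comm -mulgA.
Qed.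

(** Letter content is the invariant that will separate [s t s] from [t s t]. *)
Lemma connect_perm_eq m (u v : m.-tuple 'I_n) :
  connect (@comm_step n m) u v -> perm_eq u v.
Proof.
case/connectP => p; elim: p u => [|x p IHp] u /=; first by move=> _ ->.
case/andP => ux /IHp xv /xv; apply: perm_trans.
case/existsP: ux => i /existsP[j /and3P[_ _ /eqP->]].
by rewrite perm_sym; apply/tuple_permP; exists (tperm i j).
Qed.

Lemma simpleJ (s t : 'I_n) :
  (simple s ^ simple t = simple t * (simple s * simple t))%g.
Proof. by rewrite conjgE tpermV. Qed.

Lemma simple_braid (s t : 'I_n) : t = s.+1 :> nat ->
  (simple s * (simple t * simple s) = simple t * (simple s * simple t))%g.
Proof.
move=> ts; have e : hi s = lo t by apply: ord_inj; rewrite hiE.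
rewrite -!simpleJ /simple -e !tpermJ tpermR tpermL !tpermD //.
all: by rewrite -val_eqE /= /bump /=; lia.
Qed.

(** Induction on the width [c - a] of a pattern. If [b] is not next to [a], either [a + 1] can
    replace [a], or [a] is a descent whose removal keeps the pattern; likewise at [c]. Consecutive
    positions give adjacent descents. *)
Lemma has321_descent w : has321 w ->
  (exists2 k, descent w k & has321 (simple k * w)%g) \/
  exists s t : 'I_n, [/\ t = s.+1 :> nat, descent w s & descent w t].
Proof.
case/has321P => a [b [c [ab bc wba wcb]]].
have [d] := ubnP (c - a).
elim: d a b c ab bc wba wcb => // d IHd a b c ab bc wba wcb ltd.
have wne (x y : 'I_n.+1) : x != y :> nat -> w x != w y :> nat.
  by apply: contra => /eqP/ord_inj/perm_inj->.
have ltan : a < n by have := ltn_ord c; lia.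
pose s := Ordinal ltan; have Ds : lo s = a by apply: ord_inj.
have ltcn : c.-1 < n by have := ltn_ord c; lia.
pose t := Ordinal ltcn.
have Dt : hi t = c by apply: ord_inj; rewrite hiE /=; lia.
have [ab1|ab1] := eqVneq (b : nat) a.+1; last first.
  have [lt1|ge1] := ltnP (w b) (w (hi s)).
    by apply: (IHd (hi s) b c) => //; rewrite hiE /=; lia.
  have lt1 : w (hi s) < w b.
    by rewrite ltn_neqAle ge1 andbT wne // hiE /=; lia.
  left; exists s; first by rewrite /descent Ds; lia.
  apply/has321P; exists (hi s), b, c; rewrite !permM simple_hi Ds hiE.
  by rewrite !simple_out /=; try split=> //; lia.
have [bc1|bc1] := eqVneq (c : nat) b.+1; last first.
  have [lt1|ge1] := ltnP (w (lo t)) (w b).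
    by apply: (IHd a b (lo t)) => //=; lia.
  left; exists t; first by rewrite /descent Dt; lia.
  apply/has321P; exists a, b, (lo t); rewrite !permM simple_lo Dt.
  by rewrite !simple_out /=; try split=> //; lia.
have Ds' : hi s = b by apply: ord_inj; rewrite hiE /=.
have Dt' : lo t = b by apply: ord_inj => /=; lia.
by right; exists s, t; rewrite /descent Ds Dt Ds' Dt' /=; split=> //; lia.
Qed.

Lemma fully_commutativeE w : fully_commutative w = ~~ has321 w.
Proof.
rewrite /fully_commutative cox_lengthE; apply/idP/idP; last first.
  move=> av; apply/forallP => u; apply/forallP => v; apply/implyP => Eu.
  by apply/implyP => Ev; apply: avoid_connect Eu Ev.
move=> fc; apply/negP => h321.
suff [u [v [Eu Ev /negP]]] : exists u v : (inversions w).-tuple 'I_n,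
    [/\ is_expr w u, is_expr w v & ~~ perm_eq u v].
  apply; apply: connect_perm_eq.
  by move/forallP/(_ u)/forallP/(_ v): fc; rewrite Eu Ev.
move: {fc}h321 {-2}(inversions w) (erefl (inversions w)) => h321 m.
elim: m w h321 => [|m IHm] w h321 Dm.
  have [[k dk _]|[s [_ [_ dk _]]]] := has321_descent h321;
    have := inversions_descent dk; lia.
have [[k dk h']|[s [t [ts ds dt]]]] := has321_descent h321.
  have D := inversions_descent dk.
  have [|u [v [Eu Ev nuv]]] := IHm (simple k * w)%g h'; first by lia.
  exists [tuple of k :: u], [tuple of k :: v]; rewrite !expr_cons; split=> //.
  by rewrite perm_cons.
have e : lo t = hi s by apply: ord_inj; rewrite hiE.
have D1 := inversions_descent ds.
have dt1 : descent (simple s * w)%g t.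
  rewrite /descent !permM e simple_hi simple_out ?hiE; try lia.
  by move: ds dt; rewrite /descent e; lia.
have D2 := inversions_descent dt1.
have ds2 : descent (simple t * (simple s * w))%g s.
  rewrite /descent !permM -e simple_lo (simple_out (k := t)) /=; try lia.
  rewrite simple_lo (simple_out (k := s)) ?hiE; try lia.
  by rewrite -e.
have D3 := inversions_descent ds2.
have := reduced_ex (simple s * (simple t * (simple s * w)))%g.
case: m {IHm} Dm => [|[|m]] Dm; try lia.
have -> : inversions (simple s * (simple t * (simple s * w)))%g = m by lia.
case=> x Ex; exists [tuple of s :: t :: s :: x], [tuple of t :: s :: t :: x].
rewrite !expr_cons Ex; split=> //.
  have := congr1 (fun v => v * w)%g (simple_braid ts); rewrite -!mulgA => <-.
  exact: Ex.
(* The letter [s] occurs once more in [s t s x] than in [t s t x]. *)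
apply/negP => /seq.permP/(_ (pred1 s)) /=.
have -> : (t == s) = false by apply/eqP => ets; move: ts; rewrite ets; lia.
by rewrite eqxx; lia.
Qed.

End Words.

(** * The generating tree of 321-avoiding permutations *)

Definition inc_from n (w : 'S_n) (p : nat) : bool :=
  [forall i : 'I_n, forall j : 'I_n, (p <= i < j) ==> (w i < w j)].

Lemma inc_fromP n (w : 'S_n) p :
  reflect (forall i j : 'I_n, p <= i -> i < j -> w i < w j) (inc_from w p).
Proof.
apply: (iffP forallP) => [h i j pi ij | h i].
  by move/forallP/(_ j): (h i); rewrite pi ij.
by apply/forallP => j; apply/implyP => /andP[]; apply: h.
Qed.

Lemma inc_from_ex n (w : 'S_n) : exists p, inc_from w p.
Proof. by exists n; apply/inc_fromP => i j; have := ltn_ord i; lia. Qed.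

(** This is the position where the final increasing run starts; the run has [n - last_run w]
    entries. *)
Definition last_run n (w : 'S_n) : nat := ex_minn (inc_from_ex w).

Lemma inc_fromE n (w : 'S_n) p : inc_from w p = (last_run w <= p).
Proof.
rewrite /last_run; case: ex_minnP => d /inc_fromP inc_d min_d.
apply/idP/idP => [/min_d //|le_dp]; apply/inc_fromP => i j le_pi.
by apply: inc_d; lia.
Qed.

Lemma last_run_eq n (w : 'S_n) d :
  (forall p, inc_from w p = (d <= p)) -> last_run w = d.
Proof.
move=> h; apply/eqP; rewrite eqn_leq -inc_fromE h leqnn /=.
by rewrite -h inc_fromE.
Qed.

Lemma last_run_le n (w : 'S_n.+1) : last_run w <= n.
Proof.
rewrite -inc_fromE; apply/inc_fromP => i j.
by have := ltn_ord j; lia.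
Qed.

Lemma sum_leq_ord p m : \sum_(j < m) (p <= j) = m - p.
Proof.
elim: m => [|m IHm]; first by rewrite big_ord0.
by rewrite big_ord_recr /= IHm; lia.
Qed.

Section Insertion.
Variables (n : nat) (p : 'I_n.+2) (s : 'S_n.+1).

Let w := lift_perm p ord_max s.

Lemma ins_lift (i : 'I_n.+1) : w (lift p i) = s i :> nat.
Proof. by rewrite lift_perm_lift lift_max. Qed.

Lemma ins_max : w p = n.+1 :> nat.
Proof. by rewrite lift_perm_id. Qed.

Lemma ltn_lift (i j : 'I_n.+1) : (lift p i < lift p j) = (i < j).
Proof. by rewrite /= /bump; lia. Qed.

Lemma inversions_ins : inversions w = inversions s + (n.+1 - p).
Proof.
rewrite !inversionsE (bigD1_ord _ (erefl (xpredT p))) /= addnC; congr (_ + _).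
  apply: eq_bigr => i _; rewrite (bigD1_ord _ (erefl (xpredT p))) /=.
  rewrite ins_max ins_lift [s i > _]ltnNge [s i <= _]ltnW //= andbF add0n.
  by apply: eq_bigr => j _; rewrite !ins_lift -(ltn_lift i j).
rewrite (bigD1_ord _ (erefl (xpredT p))) /= ltnn add0n.
rewrite (eq_bigr (fun j : 'I_n.+1 => (p <= j) : nat)) => [|j _]; last first.
  by rewrite ins_max ins_lift ltn_ord andbT /bump; lia.
exact: sum_leq_ord.
Qed.

(** The inserted maximum can only be the 3 of a pattern, so a new pattern is a descending pair of
    [s] to its right. *)
Lemma has321_ins : has321 w = has321 s || ~~ inc_from s p.
Proof.
apply/idP/orP => [/has321P[a [b [c]]]|].
  case: (unliftP p b) => [b'|] ->; last first.
    by rewrite ins_max => -[_ _ lt _]; move: (ltn_ord (w a)); rewrite ltnNge lt.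
  case: (unliftP p c) => [c'|] ->; last first.
    by rewrite ins_max => -[_ _ _ lt]; move: (ltn_ord (w (lift p b'))); rewrite ltnNge lt.
  case: (unliftP p a) => [a'|] ->; rewrite !ins_lift !ltn_lift => -[ab bc wba wcb].
    by left; apply/has321P; exists a', b', c'.
  right; apply/negP => /inc_fromP /(_ b' c').
  by move: ab; rewrite /= /bump; lia.
case=> [/has321P[a [b [c [ab bc wba wcb]]]]|].
  by apply/has321P; exists (lift p a), (lift p b), (lift p c); rewrite !ins_lift !ltn_lift.
move=> /forallPn[b /forallPn[c]]; rewrite negb_imply => /andP[/andP[pb bc] ws].
have ne : s b <> s c :> nat by move/ord_inj/perm_inj => e; rewrite e ltnn in bc.
apply/has321P; exists p, (lift p b), (lift p c).
rewrite ins_max !ins_lift ltn_lift /= /bump pb ltn_ord; split=> //; lia.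
Qed.

Lemma last_run_ins_max : p = ord_max -> last_run w = last_run s.
Proof.
move=> pmax; apply: last_run_eq => d; rewrite -inc_fromE.
have liftE (i : 'I_n.+1) : lift p i = i :> nat by rewrite pmax lift_max.
apply/inc_fromP/inc_fromP => h i j.
  by rewrite -(liftE i) -(liftE j) -(ins_lift i) -(ins_lift j); apply: h.
case: (unliftP p i) => [i'|] ->; last by rewrite pmax /=; have := ltn_ord j; lia.
case: (unliftP p j) => [j'|] ->; first by rewrite !liftE !ins_lift; apply: h.
by rewrite ins_max ins_lift => _ _; apply: ltn_ord.
Qed.

(** The maximum is followed by a smaller value, so the run restarts just after it. *)
Lemma last_run_ins : p < n.+1 -> inc_from s p -> last_run w = p.+1.
Proof.
move=> lt_pn /inc_fromP inc_p; apply: last_run_eq => d.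
apply/inc_fromP/idP => [h|lt_pd i j].
  rewrite ltnNge; apply/negP => le_dp.
  have := h p (lift p (Ordinal lt_pn)) le_dp.
  by rewrite ins_max ins_lift /= /bump leqnn; have := ltn_ord (s (Ordinal lt_pn)); lia.
case: (unliftP p i) => [i'|] ->; last by lia.
case: (unliftP p j) => [j'|] ->; last first.
  by rewrite ins_max ins_lift ltn_ord.
rewrite !ins_lift ltn_lift => le_di; apply: inc_p.
by move: le_di; rewrite /= /bump; lia.
Qed.

End Insertion.

Lemma ins_bij n :
  bijective (fun ps : 'I_n.+2 * 'S_n.+1 => lift_perm ps.1 ord_max ps.2).
Proof.
apply: inj_card_bij => [[p s] [p' s'] /= e|]; last first.
  by rewrite card_prod !card_Sn card_ord factS.
have ep : p = p'.
  by apply: (@perm_inj _ (lift_perm p ord_max s)); rewrite {2}e !lift_perm_id.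
subst p'; congr (_, _); apply/permP => i; apply: (@lift_inj _ ord_max).
by rewrite -!(lift_perm_lift p) e.
Qed.

Local Open Scope ring_scope.

(** * Weighted Motzkin paths *)

Definition shift (V : nmodType) (f : nat -> V) (i : nat) : V :=
  if i is j.+1 then f j else 0.

Lemma sum_shift (V : nmodType) (f : nat -> V) K :
  f K = 0 -> \sum_(i < K.+1) shift f i = \sum_(i < K.+1) f i.
Proof. by move=> fK; rewrite big_ord_recl big_ord_recr /= fK add0r addr0. Qed.

Section Motzkin.
Variables (F : fieldType) (q : F).

(* Motzkin paths of [k] steps from height [h] to [0], with two kinds of level
   steps above height [0] and one kind at height [0]; weight [q] to the sum of
   the heights at which the steps start. *)
Fixpoint motz (k h : nat) : F :=
  if k is k'.+1 then
    q ^+ h * (motz k' h.+1 + motz k' h + (0 < h)%:R * motz k' h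
              + shift (motz k') h)
  else (h == 0%N)%:R.

Lemma motz_gt k h : (k < h)%N -> motz k h = 0.
Proof.
elim: k h => [|k IHk] [|h] //= lt_kh.
by rewrite !IHk ?mulr0 ?addr0 ?mulr0 //; lia.
Qed.

(* Total weight of the nodes [m] generations below a node labelled [r]. *)
Fixpoint tree_gf (m r : nat) : F :=
  if m is m'.+1 then
    tree_gf m' r.+1 + \sum_(t < r) q ^+ t.+1 * tree_gf m' t.+1
  else 1.

(* The elementary symmetric polynomial [e_h(1, q, .., q^(r-1))]: choices, among
   the [r] positions of the final run, of the [h] at which later insertions take
   place; these are the [h] units of height of the Motzkin path. *)
Fixpoint qelem (r h : nat) : F :=
  if r is r'.+1 then
    q ^+ h * qelem r' h + shift (fun h => q ^+ h * qelem r' h) h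
  else (h == 0%N)%:R.

(** The definition splits off the variable [1], this identity the variable [q ^+ r]. *)
Lemma qelemS r h : qelem r.+1 h.+1 = qelem r h.+1 + q ^+ r * qelem r h.
Proof.
elim: r h => [|r IHr] h; first by case: h => [|h] /=; ring.
rewrite -[LHS]/(q ^+ h.+1 * qelem r.+1 h.+1 + q ^+ h * qelem r.+1 h).
rewrite [in LHS]IHr; case: h => [|h]; first by rewrite /= !exprS; ring.
by rewrite [in LHS](IHr h) /= !exprS; ring.
Qed.

(** [q ^+ t] is the last variable of the chosen monomial. *)
Lemma sum_qelem r h : \sum_(t < r) q ^+ t * qelem t h = qelem r h.+1.
Proof.
elim: r => [|r IHr]; first by rewrite big_ord0.
by rewrite big_ord_recr qelemS IHr.
Qed.

Lemma sum_qelem_succ r h :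
  \sum_(t < r) q ^+ t.+1 * qelem t.+1 h =
  q ^+ h.+1 * qelem r h.+1 + (0 < h)%:R * (q ^+ h * qelem r h).
Proof.
case: h => [|h] /=.
  rewrite mul0r addr0 -sum_qelem mulr_sumr; apply: eq_bigr => t _.
  by rewrite exprS; ring.
rewrite mul1r -!sum_qelem !mulr_sumr -big_split /=; apply: eq_bigr => t _.
by rewrite !exprS; ring.
Qed.

(** [qelem] intertwines the two recursions: the child [r.+1] yields the up steps and one kind of
    level step, the children [t.+1] the down steps and the level steps that need positive height.
    [H] only truncates, as [motz m h] vanishes for [h > m]. *)
Lemma tree_gfE m r H : (m < H)%N ->
  tree_gf m r = \sum_(h < H.+1) qelem r h * motz m h.
Proof.
elim: m r => [|m IHm] r lt_mH.
  rewrite big_ord_recl /= big1 ?addr0 ?mulr1 => [|i _]; last by rewrite mulr0.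
  by elim: r => [|r IHr] //=; rewrite addr0 mul1r.
have lt_mH' : (m < H)%N by lia.
rewrite [LHS]/= IHm //.
under [X in _ + X = _]eq_bigr => t _ do rewrite IHm // mulr_sumr.
rewrite exchange_big.
have tail h : \sum_(t < r) q ^+ t.+1 * (qelem t.+1 h * motz m h) =
    (q ^+ h.+1 * qelem r h.+1 + (0 < h)%:R * (q ^+ h * qelem r h)) * motz m h.
  rewrite -sum_qelem_succ mulr_suml.
  by apply: eq_bigr => t _; rewrite mulrA.
under [X in _ + X = _]eq_bigr => h _ do rewrite tail.
have up : \sum_(h < H.+1) shift (fun h => q ^+ h * qelem r h * motz m h.+1) h =
    \sum_(h < H.+1) q ^+ h * qelem r h * motz m h.+1.
  by apply: sum_shift; rewrite motz_gt ?mulr0 //; lia.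
have down : \sum_(h < H.+1) shift (fun h => q ^+ h.+1 * qelem r h.+1 * motz m h) h =
    \sum_(h < H.+1) q ^+ h.+1 * qelem r h.+1 * motz m h.
  by apply: sum_shift; rewrite motz_gt ?mulr0 //; lia.
transitivity (\sum_(h < H.+1) q ^+ h * qelem r h * motz m h
  + \sum_(h < H.+1) q ^+ h * qelem r h * motz m h.+1
  + (\sum_(h < H.+1) q ^+ h.+1 * qelem r h.+1 * motz m h
  + \sum_(h < H.+1) (0 < h)%:R * (q ^+ h * qelem r h * motz m h))).
  rewrite -up -!big_split /=; apply: eq_bigr => h _ /=.
  by case: (nat_of_ord h) => [|h'] /=; ring.
rewrite -down -!big_split /=; apply: eq_bigr => h _ /=.
by case: (nat_of_ord h) => [|h'] /=; ring.
Qed.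

Lemma tree_gf1 m : tree_gf m 1 = motz m 0 + motz m 1.
Proof.
rewrite (@tree_gfE m 1 m.+1) // !big_ord_recl /= big1 => [|i _]; last first.
  by rewrite !mulr0 add0r mul0r.
by rewrite !mulr0 !addr0 !add0r !expr0 !mul1r.
Qed.

(* Lattice paths of [k] steps, [b] of them up; weight [p] to the sum over the
   steps of the number of up steps still to come. *)
Fixpoint path_gf (p : F) (k b : nat) : F :=
  if k is k'.+1 then p ^+ b * (path_gf p k' b + shift (path_gf p k') b)
  else (b == 0%N)%:R.

Lemma path_gf_gt p k b : (k < b)%N -> path_gf p k b = 0.
Proof.
elim: k b => [|k IHk] [|b] //= lt_kb.
by rewrite !IHk ?addr0 ?mulr0 //; lia.
Qed.

Hypothesis q0 : q != 0.

(* Signed paths of [k] steps from height [h] to [0], as pairs of lattice paths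
   with [a] and [a + h] up steps; the bound [K] only has to be large.  [low_bridge]
   collects those starting at height [0] with a (removed) down or [R] step. *)
Definition bridge K k h : F :=
  \sum_(a < K.+1) path_gf q^-1 k a * path_gf q k (a + h).

Definition low_bridge K k : F :=
  \sum_(a < K.+1) path_gf q^-1 k a * (path_gf q k a + shift (path_gf q k) a).

Lemma bridge0 K h : bridge K 0 h = (h == 0%N)%:R.
Proof.
rewrite /bridge big_ord_recl /= big1 ?addr0 ?mul1r // => i _.
by rewrite mul0r.
Qed.

(** The first steps of the two lattice paths change [h] by 1, 0, 0 or -1, and their weights
    [q^-1 ^+ a] and [q ^+ (a + h)] multiply to [q ^+ h]. At height 0, [low_bridge] holds the two
    cases where the first path does not go up. *)
Lemma bridgeS K k h : (k < K)%N ->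
  bridge K k.+1 h = q ^+ h * (bridge K k h.+1 + bridge K k h
     + (if h is h'.+1 then bridge K k h + bridge K k h' else low_bridge K k)).
Proof.
move=> lt_kK.
have s1 : bridge K k h.+1 = \sum_(a < K.+1)
    shift (fun a => path_gf q^-1 k a * path_gf q k (a + h.+1)) a.
  by rewrite sum_shift // path_gf_gt ?mul0r.
have s2 : bridge K k h = \sum_(a < K.+1)
    shift (fun a => path_gf q^-1 k a * path_gf q k (a + h)) a.
  by rewrite sum_shift // path_gf_gt ?mul0r.
rewrite {}s1 {1}s2 /bridge /low_bridge.
have e a : q^-1 ^+ a * q ^+ (a + h) = q ^+ h.
  by rewrite exprD exprVn mulKf ?expf_neq0.
case: h e {s2} => [|h] e; rewrite -!big_split mulr_sumr; apply: eq_bigr => a _ /=.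
  rewrite !addn0 -{1}[q ^+ 0](e a) !addn0.
  by case: (nat_of_ord a) => [|a'] /=; rewrite ?addn1 ?addn0; ring.
rewrite -(e a).
by case: (nat_of_ord a) => [|a'] /=; rewrite ?addSn ?addnS ?add0n; ring.
Qed.

Definition bridge_den K k : F := if k is k'.+1 then low_bridge K k' else 1.

(** Both sides obey the same first-step recurrence; at height 0 the extra [low_bridge] is the term
    [j = 0], where the Motzkin part is empty. *)
Lemma bridge_conv K k h : (k <= K)%N ->
  bridge K k h = \sum_(j < k.+1) motz j h * bridge_den K (k - j).
Proof.
elim: k h => [|k IHk] h lt_kK.
  by rewrite bridge0 big_ord_recr big_ord0 /= mulr1 add0r.
have le_kK := ltnW lt_kK.
rewrite bridgeS // big_ord_recl.
have dS (j : 'I_k.+1) : (k.+1 - lift ord0 j = k - j)%N by rewrite lift0 subSS.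
under [X in _ = _ + X]eq_bigr => j _ do rewrite dS lift0.
case: h => [|h].
  rewrite !IHk // expr0 /= !mul1r addrC; congr (_ + _).
  by rewrite -big_split; apply: eq_bigr => j _ /=; rewrite expr0; ring.
rewrite /= mul0r add0r !IHk // -!big_split mulr_sumr.
by apply: eq_bigr => j _ /=; ring.
Qed.

(** * Closed forms in q-binomial coefficients *)

Hypothesis qpoch_neq0 : forall n, qpoch q q n != 0.

Lemma qbinom0 k : qbinom q k 0 = 1.
Proof. by rewrite /qbinom subn0 {2}/qpoch big_ord0 mul1r divff. Qed.

Lemma qbinomnn k : qbinom q k k = 1.
Proof. by rewrite /qbinom subnn {3}/qpoch big_ord0 mulr1 divff. Qed.

Lemma qpochS n : qpoch q q n.+1 = qpoch q q n * (1 - q ^+ n.+1).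
Proof. by rewrite /qpoch big_ord_recr /= -exprS. Qed.

Lemma qbinom_pascal k b : (b < k)%N ->
  qbinom q k.+1 b.+1 = q ^+ b.+1 * qbinom q k b.+1 + qbinom q k b /\
  qbinom q k.+1 b.+1 = qbinom q k b.+1 + q ^+ (k - b) * qbinom q k b.
Proof.
move=> lt_bk; rewrite /qbinom subSS.
have -> : (k - b = (k - b.+1).+1)%N by lia.
rewrite !qpochS; set c := (k - b.+1)%N.
have -> : q ^+ k.+1 = q ^+ b.+1 * q ^+ c.+1 by rewrite -exprD; congr (q ^+ _); lia.
have n1 := qpoch_neq0 b.+1; have n2 := qpoch_neq0 c.+1.
move: n1 n2; rewrite !qpochS !mulf_eq0 !negb_or => /andP[n1 n2] /andP[n3 n4].
by split; field; rewrite n1 n2 n3 n4.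
Qed.

(** The up steps contribute [b + .. + 1], which is ['C(b.+1, 2)]; the other steps contribute the
    area counted by the q-binomial. *)
Lemma path_gfE k b : (b <= k)%N ->
  path_gf q k b = q ^+ 'C(b.+1, 2) * qbinom q k b.
Proof.
elim: k b => [|k IHk] b le_bk.
  by move: le_bk; rewrite leqn0 => /eqP->; rewrite qbinom0 mulr1.
case: b le_bk => [|b] le_bk /=; first by rewrite IHk // !qbinom0 addr0 mul1r.
have eC : 'C(b.+2, 2) = (b.+1 + 'C(b.+1, 2))%N by rewrite binS bin1 addnC.
have [lt_bk|] := ltnP b k; last first.
  move=> le_kb; have -> : b = k by lia.
  rewrite (@path_gf_gt _ _ k.+1) // IHk // !qbinomnn add0r !mulr1 -exprD.
  by congr (q ^+ _); rewrite [in RHS]binS bin1 addnC.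
have [-> _] := qbinom_pascal lt_bk.
by rewrite !IHk ?eC ?exprD //; ring.
Qed.

(** Replacing [q] by its inverse multiplies the q-binomial by [q ^- (b * (k - b))]. *)
Lemma path_gf_invE k b : (b <= k)%N ->
  path_gf q^-1 k b = q ^- ('C(b.+1, 2) + b * (k - b)) * qbinom q k b.
Proof.
elim: k b => [|k IHk] b le_bk.
  by move: le_bk; rewrite leqn0 => /eqP->; rewrite qbinom0 mulr1 invr1.
case: b le_bk => [|b] le_bk /=.
  by rewrite IHk // !qbinom0 addr0 mul1r.
have eC : 'C(b.+2, 2) = (b.+1 + 'C(b.+1, 2))%N by rewrite binS bin1 addnC.
have [lt_bk|] := ltnP b k; last first.
  move=> le_kb; have -> : b = k by lia.
  rewrite (@path_gf_gt _ _ k.+1) // IHk // !qbinomnn add0r !mulr1 exprVn -invfM -exprD.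
  by congr (q ^- _); rewrite [in RHS]binS bin1; lia.
have [_ ->] := qbinom_pascal lt_bk.
have qn0 n : q ^+ n != 0 by rewrite expf_neq0.
rewrite !IHk ?eC //.
have [c ->] : exists c, k = (b + c.+1)%N by exists (k - b).-1; lia.
have -> : (b + c.+1 - b = c.+1)%N by lia.
have -> : ((b + c.+1).+1 - b.+1 = c.+1)%N by lia.
have -> : (b + c.+1 - b.+1 = c)%N by lia.
have -> : (b.+1 * c.+1 = b * c.+1 + c.+1)%N by lia.
have -> : (b.+1 * c = b * c + c)%N by lia.
rewrite mulnS !exprD !exprS; set x := qbinom _ _ _; set y := qbinom _ _ _.
rewrite exprVn; field.
by rewrite !qn0 q0.
Qed.

Lemma low_bridgeE K k : (k <= K)%N ->
  low_bridge K k = \sum_(i < k.+1)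
     qbinom q k i * qbinom q k.+1 i * q ^- (i * (k.+1 - i)).
Proof.
move=> le_kK; rewrite /low_bridge.
rewrite (big_ord_widen _ (fun i =>
  qbinom q k i * qbinom q k.+1 i * q ^- (i * (k.+1 - i)))
  (_ : k < K.+1)%N) //.
rewrite [RHS]big_mkcond; apply: eq_bigr => a _;
  case: ltnP => [le_ak|lt_ka]; last first.
  by rewrite path_gf_gt ?mul0r.
have qn0 n : q ^+ n != 0 by rewrite expf_neq0.
(* Up to the factor [q ^+ a], the bracket is the recursion for paths with one more step. *)
rewrite -[_ + _](mulKf (qn0 a)) -[q ^+ a * (_ + _)]/(path_gf q k.+1 a).
rewrite path_gfE ?path_gf_invE //; last by lia.
rewrite subSn // mulnS !exprD.
by field; rewrite !qn0.
Qed.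

(** Heights 0 and 1 are those occurring in [tree_gf1]; their second paths merge into paths of [k.+1]
    steps. *)
Lemma high_bridgeE K k : (k <= K)%N ->
  bridge K k 0 + bridge K k 1 = \sum_(i < k.+1)
     qbinom q k i * qbinom q k.+1 i.+1 * q ^- (i * (k - i)).
Proof.
move=> le_kK; rewrite /bridge -big_split /=.
rewrite (big_ord_widen _ (fun i =>
  qbinom q k i * qbinom q k.+1 i.+1 * q ^- (i * (k - i)))
  (_ : k < K.+1)%N) //.
rewrite [RHS]big_mkcond; apply: eq_bigr => a _;
  case: ltnP => [le_ak|lt_ka]; last first.
  by rewrite path_gf_gt ?mul0r ?addr0.
have qn0 n : q ^+ n != 0 by rewrite expf_neq0.
rewrite -mulrDr addn0 addn1 [_ + path_gf _ _ _]addrC.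
rewrite -[_ + _](mulKf (qn0 a.+1)) -[q ^+ a.+1 * (_ + _)]/(path_gf q k.+1 a.+1).
rewrite path_gfE ?path_gf_invE //.
have -> : 'C(a.+2, 2) = (a.+1 + 'C(a.+1, 2))%N by rewrite binS bin1 addnC.
rewrite !exprD.
by field; rewrite !qn0.
Qed.

Lemma tree_gf_conv n :
  fps_mul (fun m => tree_gf m 1)
    (fun k => if k == 0%N then 1
       else \sum_(i < k) qbinom q k.-1 i * qbinom q k i * q ^- (i * (k - i))) n
  = \sum_(i < n.+1) qbinom q n i * qbinom q n.+1 i.+1 * q ^- (i * (n - i)).
Proof.
rewrite -(@high_bridgeE n) // !bridge_conv // -big_split; apply: eq_bigr => j _ /=.
rewrite tree_gf1 mulrDl.
suff -> : bridge_den n (n - j) = if (n - j)%N == 0%N then 1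
    else \sum_(i < n - j)
      qbinom q (n - j).-1 i * qbinom q (n - j) i * q ^- (i * (n - j - i)) by [].
have : (n - j <= n)%N by lia.
by case: (n - j)%N => [|k] //= le_kn; rewrite low_bridgeE // ltnW.
Qed.

End Motzkin.

(** * From fully commutative elements to the generating tree *)

Section Count.
Variables (F : fieldType) (q : F).

(** Each permutation carries its subtree of [m] further insertions, so that [m = 0] gives [AFC q n]
    and [n = 0] gives the tree; [n.+1 - last_run w] is the node label. *)
Definition weighted n m : F :=
  \sum_(w : 'S_n.+1 | ~~ has321 w)
    q ^+ inversions w * tree_gf q m (n.+1 - last_run w).

Lemma weightedS n m : weighted n.+1 m = weighted n m.+1.
Proof.
rewrite /weighted (reindex _ (onW_bij _ (ins_bij n))) /=.
rewrite (eq_bigl (fun ps : 'I_n.+2 * 'S_n.+1 =>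
  true && ~~ has321 (lift_perm ps.1 ord_max ps.2))) //.
rewrite -(pair_big_dep xpredT (fun p s => ~~ has321 (lift_perm p ord_max s))
  (fun p s => q ^+ inversions (lift_perm p ord_max s) *
     tree_gf q m (n.+2 - last_run (lift_perm p ord_max s)))) /=.
rewrite (exchange_big_dep (fun s => ~~ has321 s)) /=; last first.
  by move=> p s _; rewrite has321_ins negb_or => /andP[].
apply: eq_bigr => s av.
(* Insertion at the end is split off: it adds no inversion and lengthens the run by one. *)
rewrite big_mkcond big_ord_recr /= has321_ins (negPf av) inc_fromE /=.
have lt_d := last_run_le s; rewrite leqW //= inversions_ins subnn addn0.
rewrite last_run_ins_max // subSn; last by lia.
rewrite addrC mulrDr; congr (_ + _).
(* After reversal, [t.+1] entries stand to the right of the maximum: this is both the number of new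
   inversions and the new run length. *)
rewrite (reindex_inj rev_ord_inj) /= mulr_sumr.
rewrite (big_ord_widen _ (fun t => q ^+ inversions s * (q ^+ t.+1 * tree_gf q m t.+1))
  (_ : n.+1 - last_run s <= n.+1)%N); last by lia.
rewrite [RHS]big_mkcond; apply: eq_bigr => t _.
rewrite has321_ins (negPf av) negbK inc_fromE /=.
have lt_t := ltn_ord t.
have -> : (last_run s <= n.+1 - t.+1)%N = (t < n.+1 - last_run s)%N by lia.
case: ifP => // lt_td.
rewrite last_run_ins ?inversions_ins ?inc_fromE /=; try lia.
have -> : (n.+1 - (n.+1 - t.+1) = t.+1)%N by lia.
have -> : (n.+2 - (n.+1 - t.+1).+1 = t.+1)%N by lia.
by rewrite exprD mulrA.
Qed.

Lemma AFC_tree n : AFC q n = tree_gf q n 1.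
Proof.
transitivity (weighted n 0).
  by apply: eq_big => [w|w _]; rewrite ?fully_commutativeE // cox_lengthE mulr1.
have shiftm i m : weighted i m = weighted 0 (i + m).
  by elim: i m => // i IHi m; rewrite weightedS IHi addnS.
rewrite shiftm addn0 /weighted.
have S1 (w : 'S_1) : w = 1%g by apply/permP => i; rewrite !ord1.
rewrite (big_pred1 1%g) => [|w]; last first.
  rewrite (S1 w) /= eqxx; apply/negP => /has321P[a [b [c [ab]]]].
  by move: ab; rewrite !ord1.
have -> : inversions (1 : 'S_1)%g = 0%N.
  by rewrite /inversions big1 // => p; rewrite !ord1.
have -> : last_run (1 : 'S_1)%g = 0%N by apply/eqP; rewrite -leqn0 last_run_le.
by rewrite mul1r.
Qed.

End Count.

Theorem theorem6p1 :
  (fun n : nat => AFC q n) =1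
  fps_div
    (fun k : nat =>
       \sum_(i < k.+1)
          qbinom q k i * qbinom q k.+1 i.+1 * q ^- (i * (k - i)))
    (fun k : nat =>
       if k == 0%N then 1
       else \sum_(i < k)
               qbinom q k.-1 i * qbinom q k i * q ^- (i * (k - i))).
Proof.
apply/fps_divP; first exact: oner_neq0.
move=> n; rewrite -tree_gf_conv.
- by apply: eq_bigr => i _; rewrite AFC_tree.
- by rewrite tofrac_eq0 polyX_eq0.
(* No factor vanishes because [q] is not a root of unity: ['X^j.+1] and [1] differ in size. *)
move=> m; apply/prodf_neq0 => j _; rewrite -exprS subr_eq0 eq_sym.
rewrite -tofracXn -tofrac1 tofrac_eq; apply/eqP => /(congr1 (size : {poly int} -> nat)).
by rewrite size_polyXn size_poly1.
Qed.
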